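(* Let $m\ge 1$ and $k\ge 0$ be integers, $\underline\lambda=(\lambda_1,\dots,\lambda_m)\in\mathbb{R}^m$, $\mu\in\mathbb{R}$, $\delta=\mu-\sum_{j}\lambda_j$, and assume $\delta\notin\{1,\tfrac32,2,\dots,k\}$. Then there exists a family of $\mathfrak{sl}(2)$-equivariant linear maps, parametrized by the choice of non-singular matrices $[\beta]_p=(\beta^{\underline s}_{\underline i})_{|\underline s|=|\underline i|=p}$, $p=0,\dots,k$, given by $$Q^{\beta}_{\underline\lambda,\mu}:\bigoplus_{j=0}^k\mathcal{S}^{(j)}_{\delta-j}\longrightarrow\mathcal{D}^k_{\underline\lambda;\mu},\qquad \bigoplus_{r=0}^k\bigoplus_{|\underline i|=r}a_{\underline i}\,(dx)^{\delta-|\underline i|}\ \longmapsto\ \sum_{r=0}^k\sum_{|\underline i|=r}\widetilde a_{\underline i}\,\partial_{\underline i},$$ where $$\widetilde a_{\underline i}=\sum_{|\underline i|\le|\underline s|\le k}\beta^{\underline s}_{\underline i}\;a_{\underline s}^{(|\underline s|-|\underline i|)}$$ and the constants $\beta^{\underline s}_{\underline i}$ with $|\underline i|<|\underline s|\le k$ are determined from those with $|\underline s|=|\underline i|$ by the induction formula $$(2\delta-1-|\underline s|-|\underline i|)\,(|\underline s|-|\underline i|)\,\beta^{\underline s}_{\underline i}+\sum_{j=1}^m (i_j+1)(2\lambda_j+i_j)\,\beta^{\underline s}_{\underline i+\mathbf 1_j}=0 .$$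
   Context: $M$ is $\mathbb{R}$ or $S^1$ (for $S^1$, identified with the projective line, $x$ is an affine coordinate). For $\lambda\in\mathbb{R}$, $\mathcal{F}_\lambda$ is the space of smooth $\lambda$-densities $a\,(dx)^\lambda$ on $M$, with the $\mathrm{Vect}(M)$-action $L_X^\lambda(a\,(dx)^\lambda)=(Xa'+\lambda X'a)(dx)^\lambda$ for $X=X(x)\partial_x$. Multi-indices $\underline i=(i_1,\dots,i_m)$ have non-negative integer entries, $|\underline i|=\sum_j i_j$, and $\mathbf 1_j$ is the multi-index with $1$ in position $j$ and $0$ elsewhere. $\mathcal{D}^k_{\underline\lambda;\mu}$ is the space of $m$-ary differential operators of order $\le k$, $A=\sum_{|\underline i|\le k}a_{\underline i}\,\partial_{\underline i}:\mathcal{F}_{\lambda_1}\otimes\cdots\otimes\mathcal{F}_{\lambda_m}\to\mathcal{F}_\mu$, with $a_{\underline i}$ smooth functions on $M$ and $\partial_{\underline i}(\varphi_1,\dots,\varphi_m)=\varphi_1^{(i_1)}\cdots\varphi_m^{(i_m)}$. It is a $\mathrm{Vect}(M)$-module via $L_X^{\underline\lambda;\mu}(A)=L_X^\mu\circ A-\sum_{j=1}^m A(\dots,L_X^{\lambda_j}(-),\dots)$. $\mathcal{S}^{(j)}_{\lambda}$ is the direct sum of $\binom{j+m-1}{m-1}$ copies of $\mathcal{F}_\lambda$, indexed by the multi-indices $\underline i$ with $|\underline i|=j$. $\mathfrak{sl}(2)=\mathrm{Span}\{\partial_x,x\partial_x,x^2\partial_x\}\subset\mathrm{Vect}(M)$.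 The excluded set is $\{1,\frac32,2,\dots,k\}=\{\ell/2:\ \ell\in\mathbb{Z},\ 2\le\ell\le 2k\}$. *)

(* Defs.v *)
From HB Require Import structures.
From mathcomp Require Import all_boot all_order all_algebra.
From mathcomp Require Import all_classical all_reals all_analysis.
From mathcomp Require Import ring.
From mathcomp.multinomials Require Export -(notations) mpoly.

Set Implicit Arguments.
Unset Strict Implicit.
Unset Printing Implicit Defensive.

Import Order.TTheory GRing.Theory Num.Theory.
Import numFieldNormedType.Exports.

Local Open Scope ring_scope.

Section Smooth.
Variable R : realType.
Implicit Types f g : R -> R.

Definition smooth f : Prop := forall n x, derivable (derive1n n f) x 1.

Lemma smooth_derivable f x : smooth f -> derivable f x 1.
Proof. by move=> /(_ 0%N x). Qed.

Lemma derive1nSr f n : derive1n n.+1 f = derive1n n (derive1 f).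
Proof. by rewrite /derive1n iterSr. Qed.

Lemma smooth_derive1 f : smooth f -> smooth (derive1 f).
Proof. by move=> sf n x; rewrite -derive1nSr. Qed.

Let upto n f := forall l, (l < n)%N -> forall x, derivable (derive1n l f) x 1.

Let upto_D f g n : upto n f -> upto n g ->
  derive1n n (f + g) = derive1n n f + derive1n n g.
Proof.
elim: n => // n IH sf sg.
rewrite !derive1nS IH; last 2 first.
- by move=> l ln; apply: sf; exact: ltnW.
- by move=> l ln; apply: sg; exact: ltnW.
by apply/funext => x; rewrite !fctE !derive1E deriveD; [|exact: sf|exact: sg].
Qed.

Lemma smoothD f g : smooth f -> smooth g -> smooth (f + g).
Proof.
move=> sf sg n x; rewrite upto_D; last 2 first.
- by move=> l _; exact: sf.
- by move=> l _; exact: sg.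
exact: derivableD.
Qed.

Lemma derive1nZ (c : R) f n : smooth f ->
  derive1n n (c *: f) = c *: derive1n n f.
Proof.
move=> sf; elim: n => // n IH.
by rewrite !derive1nS IH; apply/funext => x; rewrite !fctE !derive1E deriveZ.
Qed.

Lemma smoothZ (c : R) f : smooth f -> smooth (c *: f).
Proof. by move=> sf n x; rewrite derive1nZ//; exact: derivableZ. Qed.

Lemma derive1M f g : smooth f -> smooth g ->
  derive1 (f * g) = derive1 f * g + f * derive1 g.
Proof.
move=> /(_ 0%N) sf /(_ 0%N) sg; apply/funext => x.
rewrite !fctE !derive1E deriveM//= addrC.
by congr (_ + _); rewrite /GRing.scale /= mulrC.
Qed.

Lemma smoothM f g : smooth f -> smooth g -> smooth (f * g).
Proof.
move=> sf sg n; suff H : upto n.+1 (f * g) by exact: H.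
elim: n f g sf sg => [|n IH] f g sf sg [|l] ln x //.
- exact: derivableM (sf 0%N x) (sg 0%N x).
- exact: derivableM (sf 0%N x) (sg 0%N x).
have IHl := IH _ _ (smooth_derive1 sf) sg.
have IHr := IH _ _ sf (smooth_derive1 sg).
rewrite derive1nSr derive1M// upto_D.
- by apply: derivableD; [exact: IHl|exact: IHr].
- by move=> j jl; apply: IHl; exact: ltn_trans jl (ltnSE ln).
- by move=> j jl; apply: IHr; exact: ltn_trans jl (ltnSE ln).
Qed.

Lemma smooth_cst (c : R) : smooth (cst c).
Proof.
move=> n x.
have -> : derive1n n (cst c : R -> R) = cst (if n is 0 then c else 0).
  case: n => // n; elim: n => [|n IH].
    by apply/funext => y; rewrite derive1nS derive1_cst.
  by rewrite derive1nS IH; apply/funext => y; rewrite derive1_cst.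
exact: derivable_cst.
Qed.

Lemma smooth_id : smooth (idfun : R -> R).
Proof.
case=> [|n] x; first exact: derivable_id.
rewrite derive1nSr.
have -> : derive1 (idfun : R -> R) = cst 1.
  by apply/funext => y; rewrite derive1E derive_id.
exact: smooth_cst.
Qed.

End Smooth.

Inductive curve := Line | Circle.

(* The circle is the projective line, with the affine coordinate x and the
   coordinate y = -1/x around infinity; the chart true is the affine one. *)
Definition chart (M : curve) : Type :=
  match M with Line => unit | Circle => bool end.

Definition affine (M : curve) : chart M :=
  match M with Line => tt | Circle => true end.

Section Densities.
Variable R : realType.

(* On the overlap, dx = y^-2 dy gives
   a(x) (dx)^lam = a(-1/y) (y^2)^(-lam) (dy)^lam. *)
Definition glued (M : curve) (lam : R) : (chart M -> R -> R) -> Prop :=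
  match M with
  | Line => fun=> True
  | Circle => fun a => forall y : R, y != 0 ->
      a false y = a true (- y^-1) * (y ^+ 2) `^ (- lam)
  end.

Definition density_pred (M : curve) (lam : R) : pred (chart M -> R -> R) :=
  fun a => `[< (forall c, smooth (a c)) /\ glued lam a >].

Record density (M : curve) (lam : R) := Density {
  density_coef :> chart M -> R -> R;
  _ : density_pred lam density_coef }.

HB.instance Definition _ M lam := [isSub for @density_coef M lam].
HB.instance Definition _ M lam := [Choice of density M lam by <:].

Lemma density_closed M lam : submod_closed (@density_pred M lam).
Proof.
split.
  apply/asboolP; split; first by move=> c; exact: smooth_cst.
  by case: M => // y _; rewrite mul0r.
move=> t u v /asboolP[su gu] /asboolP[sv gv]; apply/asboolP; split.
  by move=> c; apply: smoothD => //; exact: smoothZ.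
case: M u v su gu sv gv => // u v _ gu _ gv y y0.
by rewrite !fctE gu// gv// scalerAl mulrDl.
Qed.

HB.instance Definition _ M lam :=
  GRing.isSubmodClosed.Build R (chart M -> R -> R) (@density_pred M lam)
    (GRing.submod_closed_semi (@density_closed M lam)).
HB.instance Definition _ M lam :=
  [SubChoice_isSubLmodule of density M lam by <:].


Lemma densityP M lam (a : density M lam) :
  (forall c, smooth (a c)) /\ glued lam a.
Proof. by case: a => a /= /asboolP. Qed.

Lemma derive1_infinity lam (a : density Circle lam) (y : R) : y != 0 ->
  derive1 (a false) y =
    (derive1 (a true) (- y^-1) * y ^- 2
      - 2 * lam * y^-1 * a true (- y^-1)) * (y ^+ 2) `^ (- lam).
Proof.
move=> y0; have [sa ga] := densityP a.
have y2 : 0 < y ^+ 2 by rewrite exprn_even_gt0.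
have dy : is_derive y 1 (fun z : R => - z^-1) (y ^- 2).
  have h := is_deriveN (is_deriveV y0 (is_derive_id y (1 : R))).
  by apply: (is_derive_eq h); rewrite /GRing.scale /= mulr1 opprK.
have da : is_derive (- y^-1) 1 (a true) (derive1 (a true) (- y^-1)).
  by apply: DeriveDef; [exact: smooth_derivable|rewrite derive1E].
have dsq : is_derive y 1 (fun z : R => z ^+ 2) (2 * y).
  have h := is_deriveX 2 (is_derive_id y (1 : R)).
  by apply: (is_derive_eq h); rewrite /GRing.scale /= mulr1 expr1.
have dp := is_derive1_powR (- lam) y2.
have d1 := @is_derive1_comp R (a true) (fun z : R => - z^-1) _ _ _ da dy.
have d2 := @is_derive1_comp R (fun z : R => z `^ (- lam))
  (fun z : R => z ^+ 2) _ _ _ dp dsq.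
have [_ d3] := is_deriveM d1 d2.
rewrite derive1E; transitivity ('D_1 ((a true \o (fun z : R => - z^-1)) *
   ((fun z : R => z `^ (- lam)) \o (fun z : R => z ^+ 2))) y).
  apply: near_eq_derive => /=.
  have : \forall z \near y, z != 0 by exact: (open_neq y0).
  by apply: filterS => z; exact: ga.
rewrite d3 /GRing.scale /= powRD ?(gt_eqF y2) ?implybT//.
rewrite powR_inv1 ?ltW//; field.
exact: y0.
Qed.

Definition lie_coef M (X : chart M -> R -> R) (lam : R) (a : chart M -> R -> R)
    : chart M -> R -> R :=
  fun c => X c * derive1 (a c) + lam *: (derive1 (X c) * a c).

Lemma lie_coefP M (X : density M (-1)) lam (a : density M lam) :
  density_pred lam (lie_coef X lam a).
Proof.
apply/asboolP; split.
  move=> c; have [sX _] := densityP X; have [sa _] := densityP a.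
  apply: smoothD; first exact: smoothM (sX c) (smooth_derive1 (sa c)).
  exact/smoothZ/smoothM/(sa c)/smooth_derive1/(sX c).
case: M X a => // X a y y0; rewrite /lie_coef !fctE.
have [_ /(_ y y0) gX] := densityP X; have [_ /(_ y y0) ga] := densityP a.
rewrite (derive1_infinity X y0) (derive1_infinity a y0) gX ga.
rewrite !opprK powRr1 ?sqr_ge0// /GRing.scale /=; field.
exact: y0.
Qed.

(* A vector field X(x) d/dx is the same thing as a density of weight -1. *)
Definition vect (M : curve) := density M (-1).

Definition lie M (X : vect M) lam (a : density M lam) : density M lam :=
  Density (lie_coefP X a).

Lemma sl2_gen_pred M (n : nat) : (n <= 2)%N ->
  density_pred (-1) (match M return chart M -> R -> R with
    | Line => fun _ x => x ^+ n
    | Circle => fun c x => if c then x ^+ n else (-1) ^+ n * x ^+ (2 - n)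
    end).
Proof.
have sX l : smooth (fun x : R => x ^+ l).
  elim: l => [|l IH]; first exact: smooth_cst.
  have -> : (fun x : R => x ^+ l.+1) = idfun * (fun x => x ^+ l).
    by apply/funext => x; rewrite exprS.
  exact/smoothM/IH/smooth_id.
move=> n2; apply/asboolP; case: M => /=; split=> //.
  by case=> //; exact/smoothZ/sX.
move=> y y0; rewrite opprK powRr1 ?sqr_ge0// [in RHS]exprNn -mulrA.
congr (_ * _).
by rewrite exprVn mulrC expfB_cond// (negbTE y0).
Qed.

(* x^n d/dx, which reads (-1)^n y^(2-n) d/dy in the coordinate y = -1/x. *)
Definition sl2_gen M n (n2 : (n <= 2)%N) : vect M :=
  Density (sl2_gen_pred M n2).

Definition sl2 M (X : vect M) : Prop :=
  exists u v w : R,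
    X = u *: sl2_gen M (isT : (0 <= 2)%N) + v *: sl2_gen M (isT : (1 <= 2)%N)
        + w *: sl2_gen M (isT : (2 <= 2)%N).

End Densities.

Section Operators.
Variables (R : realType) (M : curve) (m : nat).

Definition operator (lam : 'I_m -> R) (mu : R) : Type :=
  (forall j, density M (lam j)) -> density M mu.

(* The finite type bmultinom m k.+1 consists of the multi-indices of length m
   and degree at most k. *)
Definition diffop (k : nat) (lam : 'I_m -> R) (mu : R)
    (A : operator lam mu) : Prop :=
  forall c : chart M, exists2 b : bmultinom m k.+1 -> R -> R,
    (forall i, smooth (b i)) &
    (forall phi x, A phi c x =
       \sum_i b i x * \prod_(j < m) derive1n (i j) (phi j c) x).

Definition lie_op (X : vect R M) (lam : 'I_m -> R) (mu : R)
    (A : operator lam mu) : operator lam mu :=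
  fun phi => lie X (A phi) - \sum_(j < m) A (dfwith phi j (lie X (phi j))).

Definition symbol (k : nat) (delta : R) : Type :=
  forall s : bmultinom m k.+1, density M (delta - (mdeg s)%:R).

Definition lie_symbol (X : vect R M) (k : nat) (delta : R)
    (a : symbol k delta) : symbol k delta :=
  fun s => lie X (a s).

End Operators.

Definition homogeneous (m p : nat) : {set bmultinom m p.+1} :=
  [set i : bmultinom m p.+1 | mdeg i == p]%SET.

Section Coefficients.
Variables (R : realType) (m k : nat).

(* beta s i stands for the constant with upper index s and lower index i; only
   the values with |i| <= |s| <= k are meaningful. *)
Definition extends_top (B : forall p : 'I_k.+1, 'M[R]_#|homogeneous m p|)
    (beta : multinom m -> multinom m -> R) : Prop :=
  forall (p : 'I_k.+1) (a b : 'I_#|homogeneous m p|),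
    beta (enum_val a) (enum_val b) = B p a b.

Definition induction_formula (lam : 'I_m -> R) (delta : R)
    (beta : multinom m -> multinom m -> R) : Prop :=
  forall s i : multinom m, (mdeg i < mdeg s <= k)%N ->
    (2 * delta - 1 - (mdeg s)%:R - (mdeg i)%:R) * ((mdeg s)%:R - (mdeg i)%:R)
      * beta s i
    + \sum_(j < m) ((i j)%:R + 1) * (2 * lam j + (i j)%:R)
        * beta s (mnm_add i (mnm1 j)) = 0.

Definition quantized_coef (M : curve) (delta : R)
    (beta : multinom m -> multinom m -> R) (a : symbol M m k delta)
    (i : bmultinom m k.+1) (x : R) : R :=
  \sum_(s : bmultinom m k.+1 | (mdeg i <= mdeg s)%N)
    beta s i * derive1n (mdeg s - mdeg i) (a s (affine M)) x.

End Coefficients.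

(* Main.v *)
Require Import Defs.
From mathcomp Require Import all_boot all_order all_algebra.
From mathcomp Require Import all_classical all_reals all_analysis.
From mathcomp.multinomials Require Import -(notations) mpoly.
From mathcomp Require Import ring lra.

Import Order.TTheory GRing.Theory Num.Theory.
Import numFieldNormedType.Exports.

Local Open Scope ring_scope.

Set Implicit Arguments.
Unset Strict Implicit.
Unset Printing Implicit Defensive.

(** For a fixed upper index [s], with [n = |s|], the induction formula says that
    the form [u |-> sum_i beta_i u_0(n - |i|) prod_j u_j(i_j)] is annihilated by
    the derivation acting on each slot as [u(p) |-> p (p - 1 + 2 lambda) u(p - 1)],
    with weight [delta - n] in slot 0. For a quadratic vector field [X], the jets
    of [L_X f] are [X] times the shifted jets, plus [X'] times the Euler
    operator, plus [X''/2] times this derivation, which gives the infinitesimal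
    equivariance. On the circle one also needs invariance under [x |-> -1/x]:
    by Bol's formula the jets at infinity are, up to homogeneous factors, the
    value at [t = -y] of a curve of jets whose velocity is that same derivation,
    so the form is constant along the curve and may be evaluated at [t = 0]. *)

(** * The pairing of jets and its infinitesimal invariance *)

Definition pairing (R : comNzRingType) (m k n : nat) (beta : multinom m -> R)
    (u0 : nat -> R) (u : 'I_m -> nat -> R) : R :=
  \sum_(i : bmultinom m k.+1 | (mdeg i <= n)%N)
    beta i * (u0 (n - mdeg i)%N * \prod_(j < m) u j (i j)).

(* The derivative of [pairing] at [(u0, u)] in the direction [(d0, d)]. *)
Definition pairing_polar (R : comNzRingType) (m k n : nat)
    (beta : multinom m -> R) (d0 : nat -> R) (d : 'I_m -> nat -> R)
    (u0 : nat -> R) (u : 'I_m -> nat -> R) : R :=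
  \sum_(i : bmultinom m k.+1 | (mdeg i <= n)%N)
    beta i * (d0 (n - mdeg i)%N * \prod_(j < m) u j (i j) +
      u0 (n - mdeg i)%N *
        \sum_(j < m) d j (i j) * \prod_(l < m | l != j) u l (i l)).

(** The action of [x^2 d/dx] at the origin on the jets of densities of weight [lam]. At [n = 0] the
    factor [n%:R] cancels the truncated predecessor. *)
Definition lowering (R : comNzRingType) (lam : R) (u : nat -> R) (n : nat) : R :=
  n%:R * (n.-1%:R + 2 * lam) * u n.-1.

Lemma sum_bmultinom_shift (R : comNzRingType) (m k n : nat) (j : 'I_m)
    (F : multinom m -> R) : (n <= k)%N ->
  (forall i : multinom m, i j = 0%N -> F i = 0) ->
  \sum_(i : bmultinom m k.+1 | (mdeg i <= n)%N) F i =
  \sum_(i : bmultinom m k.+1 | (mdeg i < n)%N) F (mnm_add i (mnm1 j)).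
Proof.
move=> nk F0.
(* Both maps are made total by a default value: [up] meets it only in degree [k], and [dn] never
   does. *)
pose up (i : bmultinom m k.+1) : bmultinom m k.+1 :=
  odflt i (insub (mnm_add i (mnm1 j))).
pose dn (i : bmultinom m k.+1) : bmultinom m k.+1 :=
  odflt i (insub (mnm_sub i (mnm1 j))).
have upE (i : bmultinom m k.+1) : (mdeg i < n)%N ->
    up i = mnm_add i (mnm1 j) :> multinom m.
  move=> i_n; rewrite /up insubT //=.
  by rewrite mdegD mdeg1 addn1 ltnS (leq_trans i_n).
have dnE (i : bmultinom m k.+1) : dn i = mnm_sub i (mnm1 j) :> multinom m.
  rewrite /dn insubT //=.
  by rewrite (leq_ltn_trans (mdegB _ _)) ?bmdeg.
have subK (i : multinom m) : i j != 0%N ->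
    mnm_add (mnm_sub i (mnm1 j)) (mnm1 j) = i.
  move=> ij; apply: submK; apply/mnm_lepP => l; rewrite mnm1E.
  by case: eqP => [<-|//]; rewrite lt0n.
rewrite (bigID (fun i : bmultinom m k.+1 => i j != 0%N)) /= addrC.
rewrite big1 ?add0r; last first.
  by move=> i /andP[_]; rewrite negbK => /eqP; exact: F0.
rewrite (reindex_onto up dn) /=; last first.
  move=> i /andP[i_n ij]; apply: val_inj => /=.
  have dg : mdeg i = (mdeg (dn i)).+1.
    by rewrite -[in LHS](subK i ij) mdegD mdeg1 dnE addn1.
  by rewrite upE -?dg// dnE subK.
(* The condition that [dn] undoes [up] forces [up i] to have degree |i| + 1, which excludes the
   indices where [up] takes its default. *)
apply: eq_big => [i|i /andP[/andP[ui ij] /eqP di]].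
  apply/idP/idP => [/andP[/andP[ui ij] /eqP di]|i_n].
    have : mdeg (up i) = (mdeg i).+1.
      by rewrite -[in LHS](subK _ ij) mdegD mdeg1 addn1 -dnE di.
    by move=> <-.
  have -> : dn (up i) == i.
    by apply/eqP/val_inj; rewrite /= dnE upE// addmK.
  by rewrite upE// mdegD mdeg1 addn1 i_n mnmDE mnm1E eqxx addn1.
congr F; rewrite -[LHS](subK _ ij); congr mnm_add.
by rewrite -dnE di.
Qed.

(** For [lam0] = delta - n this is the induction formula at one upper index of degree n. The left
    side is the coefficient of [u0 (n - |i| - 1)] times the product of the [u j (i j)] in the
    polarization along [lowering]. *)
Definition sl2_invariant (R : comNzRingType) (m n : nat) (lam0 : R)
    (lam : 'I_m -> R) (beta : multinom m -> R) : Prop :=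
  forall i : multinom m, (mdeg i < n)%N ->
    (n - mdeg i)%:R * ((n - mdeg i).-1%:R + 2 * lam0) * beta i +
    \sum_(j < m) (i j).+1%:R * ((i j)%:R + 2 * lam j) *
      beta (mnm_add i (mnm1 j)) = 0.

(** Lowering slot j and then replacing i by i + 1_j brings every term to a monomial of total order n
    - 1. Its collected coefficient is the left side of [sl2_invariant]; the terms with |i| = n drop
    out of slot 0 because [lowering] vanishes at order 0. *)
Lemma pairing_polar_lowering (R : comNzRingType) (m k n : nat)
    (beta : multinom m -> R) (lam0 : R) (lam : 'I_m -> R) (u0 : nat -> R)
    (u : 'I_m -> nat -> R) : (n <= k)%N ->
  sl2_invariant n lam0 lam beta ->
  pairing_polar k n beta (lowering lam0 u0)
    (fun j => lowering (lam j) (u j)) u0 u = 0.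
Proof.
move=> nk rec; rewrite /pairing_polar.
under eq_bigr do rewrite mulrDr 2!mulr_sumr.
rewrite big_split exchange_big /=.
pose F j (i : multinom m) := beta i * (u0 (n - mdeg i)%N *
  (lowering (lam j) (u j) (i j) * \prod_(l < m | l != j) u l (i l))).
under [X in _ + X]eq_bigr => j _.
  rewrite (@sum_bmultinom_shift _ _ _ _ j (F j) nk); last first.
    by move=> i ij; rewrite /F /lowering ij !mul0r !mulr0.
  over.
rewrite /= exchange_big /=.
rewrite (bigID (fun i : bmultinom m k.+1 => (mdeg i < n)%N)) /=.
rewrite [X in _ + X + _]big1 ?addr0; last first.
  move=> i /andP[_]; rewrite -leqNgt -subn_eq0 => /eqP ->.
  by rewrite /lowering !mul0r mulr0.
rewrite (eq_bigl (fun i : bmultinom m k.+1 => (mdeg i < n)%N)); last first.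
  by move=> i /=; case: (ltnP (mdeg i) n) => h; rewrite ?andbF// ltnW.
rewrite -big_split big1//= => i i_n.
transitivity (((n - mdeg i)%:R * ((n - mdeg i).-1%:R + 2 * lam0) * beta i +
    \sum_(j < m) (i j).+1%:R * ((i j)%:R + 2 * lam j) *
      beta (mnm_add i (mnm1 j))) *
   (u0 (n - mdeg i).-1 * \prod_(j < m) u j (i j))); last by rewrite rec ?mul0r.
rewrite mulrDl mulr_suml; congr (_ + _); first by rewrite /lowering; ring.
apply: eq_bigr => j _; rewrite /F /lowering mnmDE mnm1E eqxx addn1 /=.
rewrite mdegD mdeg1 addn1 subnS [in RHS](bigD1 j)//=.
rewrite (eq_bigr (fun l => u l (i l))); first by ring.
by move=> l lj; rewrite mnmDE mnm1E eq_sym (negbTE lj) addn0.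
Qed.

(** The orders n - |i| and i_1, ..., i_m add up to n in every monomial, so the Euler operator acts
    by a scalar. *)
Lemma pairing_polar_euler (R : comNzRingType) (m k n : nat)
    (beta : multinom m -> R) (lam0 : R) (lam : 'I_m -> R) (u0 : nat -> R)
    (u : 'I_m -> nat -> R) :
  pairing_polar k n beta (fun i => (i%:R + lam0) * u0 i)
    (fun j i => (i%:R + lam j) * u j i) u0 u =
  (n%:R + lam0 + \sum_(j < m) lam j) * pairing k n beta u0 u.
Proof.
rewrite /pairing_polar /pairing mulr_sumr; apply: eq_bigr => i i_n.
have -> : \sum_(j < m) ((i j)%:R + lam j) * u j (i j) *
    \prod_(l < m | l != j) u l (i l) =
    ((mdeg i)%:R + \sum_(j < m) lam j) * \prod_(j < m) u j (i j).
  rewrite mdegE natr_sum -big_split mulr_suml; apply: eq_bigr => j _ /=.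
  by rewrite -mulrA [in RHS](bigD1 j).
by rewrite natrB//; ring.
Qed.

Lemma pairing_polarD (R : comNzRingType) (m k n : nat) (beta : multinom m -> R)
    (a b c : R) (d0 e0 f0 : nat -> R) (d e f : 'I_m -> nat -> R)
    (u0 : nat -> R) (u : 'I_m -> nat -> R) :
  pairing_polar k n beta (fun i => a * d0 i + b * e0 i + c * f0 i)
    (fun j i => a * d j i + b * e j i + c * f j i) u0 u =
  a * pairing_polar k n beta d0 d u0 u + b * pairing_polar k n beta e0 e u0 u
    + c * pairing_polar k n beta f0 f u0 u.
Proof.
rewrite /pairing_polar !mulr_sumr -!big_split /=; apply: eq_bigr => i _.
have -> : \sum_(j < m) (a * d j (i j) + b * e j (i j) + c * f j (i j)) *
     \prod_(l < m | l != j) u l (i l) =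
   a * (\sum_(j < m) d j (i j) * \prod_(l < m | l != j) u l (i l)) +
   b * (\sum_(j < m) e j (i j) * \prod_(l < m | l != j) u l (i l)) +
   c * (\sum_(j < m) f j (i j) * \prod_(l < m | l != j) u l (i l)).
  by rewrite !mulr_sumr -!big_split /=; apply: eq_bigr => j _; ring.
ring.
Qed.

Lemma pairing_scale (R : comNzRingType) (m k n : nat) (beta : multinom m -> R)
    (z c0 : R) (c : 'I_m -> R) (u0 : nat -> R) (u : 'I_m -> nat -> R) :
  pairing k n beta (fun i => c0 * z ^+ i * u0 i)
    (fun j i => c j * z ^+ i * u j i) =
  c0 * (\prod_(j < m) c j) * z ^+ n * pairing k n beta u0 u.
Proof.
rewrite /pairing mulr_sumr; apply: eq_bigr => i i_n.
have -> : \prod_(j < m) (c j * z ^+ i j * u j (i j)) =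
    (\prod_(j < m) c j) * z ^+ mdeg i * \prod_(j < m) u j (i j).
  by rewrite !big_split /= mdegE expr_sum.
by rewrite -[in z ^+ n](subnK i_n) exprD; ring.
Qed.

(** Multilinearity splits the polarization into one pairing per slot, the shape in which a Lie
    derivative acts on an operator and its arguments. *)
Lemma pairing_polarE (R : comNzRingType) (m k n : nat) (beta : multinom m -> R)
    (d0 : nat -> R) (d : 'I_m -> nat -> R) (u0 : nat -> R)
    (u : 'I_m -> nat -> R) :
  pairing_polar k n beta d0 d u0 u = pairing k n beta d0 u +
    \sum_(j < m) pairing k n beta u0 (fun l => if l == j then d j else u l).
Proof.
rewrite exchange_big -big_split /=; apply: eq_bigr => i _.
rewrite mulrDr; congr (_ + _); rewrite !mulr_sumr; apply: eq_bigr => j _.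
rewrite [in RHS](bigD1 j)//= eqxx; do 3!congr (_ * _).
by apply: eq_bigr => l /negbTE ->.
Qed.

(** * Derivatives of finite sums and products *)

Lemma is_derive_big_sum (R : realType) (I : Type) (r : seq I) (P : pred I)
    (f : I -> R -> R) (df : I -> R) (x : R) :
  (forall i, is_derive x 1 (f i) (df i)) ->
  is_derive x 1 (fun t => \sum_(i <- r | P i) f i t)
    (\sum_(i <- r | P i) df i).
Proof.
move=> fd; elim: r => [|i r IH].
  under eq_fun do rewrite big_nil.
  by rewrite big_nil; exact: is_derive_cst.
under eq_fun do rewrite big_cons.
by rewrite big_cons; case: (P i) => //; exact: is_deriveD.
Qed.

Lemma is_derive_big_prod (R : realType) (I : finType) (f : I -> R -> R)
    (df : I -> R) (x : R) :
  (forall i, is_derive x 1 (f i) (df i)) ->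
  is_derive x 1 (fun t => \prod_i f i t)
    (\sum_i df i * \prod_(l | l != i) f l x).
Proof.
(* The induction over the enumeration carries its duplicate-freeness: the head index must differ
   from every index of the tail for the Leibniz terms to separate. *)
move=> fd; elim: (index_enum I) (index_enum_uniq I) => [_|i r IH /= /andP[ir ur]].
  under eq_fun do rewrite big_nil.
  by rewrite big_nil; exact: is_derive_cst.
under eq_fun do rewrite big_cons.
have h := is_deriveM (fd i) (IH ur); apply: (is_derive_eq h).
rewrite /GRing.scale /= big_cons big_cons eqxx /= addrC mulrC; congr (_ * _ + _).
  rewrite [RHS]big_seq_cond [LHS]big_seq; apply: eq_bigl => l.
  by case: (boolP (l \in r)) => //= lr; case: eqP lr ir => // -> ->.
rewrite mulr_sumr big_seq [RHS]big_seq; apply: eq_bigr => j jr.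
rewrite big_cons ifT; first by ring.
by apply: contraNN ir => /eqP ->.
Qed.

Lemma is_derive_pairing (R : realType) (m k n : nat) (beta : multinom m -> R)
    (v0 : nat -> R -> R) (v : 'I_m -> nat -> R -> R) (d0 : nat -> R)
    (d : 'I_m -> nat -> R) (x : R) :
  (forall i, is_derive x 1 (v0 i) (d0 i)) ->
  (forall j i, is_derive x 1 (v j i) (d j i)) ->
  is_derive x 1
    (fun t => pairing k n beta (fun i => v0 i t) (fun j i => v j i t))
    (pairing_polar k n beta d0 d (fun i => v0 i x) (fun j i => v j i x)).
Proof.
move=> h0 h; apply: is_derive_big_sum => i.
have hp := @is_derive_big_prod R 'I_m (fun j => v j (i j)) _ x
  (fun j => h j (i j)).
have hc := is_deriveZ (beta i) (is_deriveM (h0 (n - mdeg i)%N) hp).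
by apply: (is_derive_eq hc); rewrite /GRing.scale /=; ring.
Qed.

(** * Jets of a Lie derivative along a quadratic field *)

Lemma smooth_is_derive (R : realType) (f : R -> R) (n : nat) (x : R) :
  smooth f -> is_derive x 1 (derive1n n f) (derive1n n.+1 f x).
Proof.
by move=> sf; apply: DeriveDef; [exact: sf|rewrite derive1nS derive1E].
Qed.

Lemma is_derive_derive1 (R : realType) (f : R -> R) (x df : R) :
  is_derive x 1 f df -> derive1 f x = df.
Proof. by case=> _ <-; rewrite derive1E. Qed.

(** Since the third derivative of [X] vanishes, the Leibniz expansion stops at X''. The coefficient
    of X'' f^(n-1) is n(n-1)/2 + n lam, which is half the factor in [lowering]. *)
Lemma derive1n_lie (R : realType) (X f : R -> R) (lam : R) (n : nat) (x : R) :
  smooth X -> smooth f -> (forall y, derive1n 3 X y = 0) ->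
  derive1n n (X * derive1 f + lam *: (derive1 X * f)) x =
  X x * derive1n n.+1 f x + derive1 X x * ((n%:R + lam) * derive1n n f x)
  + derive1n 2 X x / 2 * lowering lam (fun i => derive1n i f x) n.
Proof.
move=> sX sf X3; elim: n x => [|n IH] x.
  by rewrite /lowering !fctE /GRing.scale /=; ring.
have -> : derive1n n.+1 (X * derive1 f + lam *: (derive1 X * f)) =
    derive1 (fun x => X x * derive1n n.+1 f x
      + derive1 X x * ((n%:R + lam) * derive1n n f x)
      + derive1n 2 X x / 2 * lowering lam (fun i => derive1n i f x) n).
  by rewrite derive1nS; congr derive1; apply/funext => y; exact: IH.
apply: is_derive_derive1.
have X0 := @smooth_is_derive _ _ 0 x sX.
have X1 := @smooth_is_derive _ _ 1 x sX.
have X2 := @smooth_is_derive _ _ 2 x sX.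
have F i := @smooth_is_derive _ _ i x sf.
have h := is_deriveD (is_deriveD (is_deriveM X0 (F n.+1))
  (is_deriveM X1 (is_deriveZ (n%:R + lam) (F n))))
  (is_deriveM (is_deriveZ 2^-1 X2)
     (is_deriveZ (n%:R * (n.-1%:R + 2 * lam)) (F n.-1))).
have -> : (fun z => X z * derive1n n.+1 f z
      + derive1 X z * ((n%:R + lam) * derive1n n f z)
      + derive1n 2 X z / 2 * lowering lam (fun i => derive1n i f z) n) =
  X * derive1n n.+1 f + derive1n 1 X * ((n%:R + lam) *: derive1n n f) +
  (2^-1 *: derive1n 2 X) * ((n%:R * (n.-1%:R + 2 * lam)) *: derive1n n.-1 f).
  by apply/funext => y; rewrite /lowering !fctE /GRing.scale /=; ring.
apply: (is_derive_eq h).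
(* Writing X'' as c + c with c = X''/2 an atom leaves a division-free identity for [ring]. *)
have X2E : derive1n 2 X x = derive1n 2 X x / 2 + derive1n 2 X x / 2.
  exact: splitr.
rewrite X3 /lowering /GRing.scale /=.
move: X2E; case: n {IH h} => [|n] /=; rewrite /GRing.scale /=.
  move: (derive1 (derive1 X) x) (derive1 X x) (X x) (f x) (derive1 f x)
    (derive1 (derive1 f) x) => X2' X1' X0' f0 f1 f2.
  by set c := _ / 2; rewrite [2^-1 * _]mulrC -/c => ->; move: c => c; ring.
move: (derive1 (derive1 X) x) (derive1 X x) (X x) (derive1n n f x)
  (derive1 (derive1n n f) x) (derive1 (derive1 (derive1n n f)) x)
  (derive1 (derive1 (derive1 (derive1n n f))) x) => X2' X1' X0' f0 f1 f2 f3.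
by set c := _ / 2; rewrite [2^-1 * _]mulrC -/c => ->; move: c => c; ring.
Qed.

(** * Inversion *)

(* The coefficients of Bol's formula for the derivatives of
   [x^(-2 lam) f(-1/x)]. *)
Definition bol_coef (R : comNzRingType) (lam : R) (n k : nat) : R :=
  'C(n, k)%:R * \prod_(k <= j < n) (2 * lam + j%:R).

Lemma bol_coefS0 (R : comNzRingType) (lam : R) n :
  bol_coef lam n.+1 0 = (2 * lam + n%:R) * bol_coef lam n 0.
Proof. by rewrite /bol_coef !bin0 big_nat_recr//=; ring. Qed.

(** This recursion is what differentiating Bol's formula once more produces. It rests on (k+1)
    C(n,k+1) = (n-k) C(n,k). *)
Lemma bol_coefSS (R : comNzRingType) (lam : R) n k :
  bol_coef lam n.+1 k.+1 =
  (2 * lam + n%:R + k.+1%:R) * bol_coef lam n k.+1 + bol_coef lam n k.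
Proof.
rewrite /bol_coef binS; have [nk|kn|->] := ltngtP n k.
- by rewrite !bin_small// ?leqW//; ring.
- rewrite big_nat_recr//= [X in _ + _ * X](@big_ltn _ _ _ k)//.
  have : 'C(n, k.+1)%:R * k.+1%:R = (n%:R - k%:R) * 'C(n, k)%:R :> R.
    by rewrite -natrB 1?ltnW// -!natrM mulnC mul_bin_left.
  set A := \prod_(_ <= _ < _) _; set C1 := 'C(n, k.+1)%:R => h.
  rewrite natrD -/C1.
  transitivity (A * ((2 * lam + n%:R) * C1 + C1 * k.+1%:R +
    (2 * lam + k%:R) * 'C(n, k)%:R)).
    by rewrite h; ring.
  by ring.
- by rewrite bin_small// binn !big_geq//; ring.
Qed.

Lemma bol_coef_lowering (R : comNzRingType) (lam : R) n k : (k <= n)%N ->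
  (n.+1 - k)%:R * bol_coef lam n.+1 k =
  n.+1%:R * (n%:R + 2 * lam) * bol_coef lam n k.
Proof.
move=> kn; rewrite /bol_coef big_nat_recr//=.
have : (n.+1 - k)%:R * 'C(n.+1, k)%:R = n.+1%:R * 'C(n, k)%:R :> R.
  by rewrite -!natrM -mul_bin_down.
by rewrite mulrA => ->; ring.
Qed.

(** The exponential of [t] times [lowering], applied to the jet [g]: the integral curve of
    [lowering] that starts at [g]. *)
Definition bol (R : comNzRingType) (lam : R) (g : nat -> R) (n : nat) (t : R) : R :=
  \sum_(k < n.+1) bol_coef lam n k * t ^+ (n - k) * g k.

Lemma bol0 (R : comNzRingType) (lam : R) (g : nat -> R) n : bol lam g n 0 = g n.
Proof.
rewrite /bol big_ord_recr /= big1 ?add0r.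
  by rewrite subnn /bol_coef binn big_geq//; ring.
by move=> i _; rewrite expr0n subn_eq0 leqNgt ltn_ord /= mulr0 mul0r.
Qed.

Lemma is_derive_bol (R : realType) (lam : R) (g : nat -> R) n (t : R) :
  is_derive t 1 (bol lam g n) (lowering lam (fun i => bol lam g i t) n).
Proof.
have h : is_derive t 1 (bol lam g n)
    (\sum_(k < n.+1) bol_coef lam n k * g k * ((n - k)%:R * t ^+ (n - k).-1)).
  apply: is_derive_big_sum => k.
  have h := is_deriveZ (bol_coef lam n k * g k)
    (is_deriveX (n - k) (is_derive_id t (1 : R))).
  have -> : (fun t => bol_coef lam n k * t ^+ (n - k) * g k) =
     (bol_coef lam n k * g k) *: (id ^+ (n - k)).
    by apply/funext => z; rewrite !fctE /GRing.scale /=; ring.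
  by apply: (is_derive_eq h); rewrite /GRing.scale /=; ring.
apply: (is_derive_eq h); rewrite /lowering.
case: n {h} => [|n]; first by rewrite big_ord1 subnn; ring.
rewrite big_ord_recr subnn /= !mul0r mulr0 addr0 mulr_sumr.
apply: eq_bigr => k _; have kn : (k <= n)%N by rewrite -ltnS.
transitivity ((n.+1 - k)%:R * bol_coef lam n.+1 k * (t ^+ (n - k) * g k)).
  by rewrite subSn//=; ring.
by rewrite bol_coef_lowering//; ring.
Qed.

Lemma derive1n_infinity (R : realType) (lam : R) (a : density Circle lam)
    (n : nat) (y : R) : y != 0 ->
  derive1n n (a false) y = (y ^+ 2) `^ (- lam) * (y ^- 2) ^+ n *
    bol lam (fun k => derive1n k (a true) (- y^-1)) n (- y).
Proof.
move=> y0; have [sa ga] := densityP a.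
(* All powers are gathered in z = -1/y, because dz/dy = z^2 and the prefactor has logarithmic
   derivative 2 lam z. The induction then only shifts exponents of z. *)
suff -> : derive1n n (a false) y = (y ^+ 2) `^ (- lam) *
    \sum_(k < n.+1) bol_coef lam n k *
      ((- y^-1) ^+ (n + k) * derive1n k (a true) (- y^-1)).
  rewrite -mulrA; congr (_ * _); rewrite mulr_sumr; apply: eq_bigr => k _.
  have kn : (k <= n)%N by rewrite -ltnS.
  have -> : y ^- 2 = (- y^-1) ^+ 2 by rewrite sqrrN exprVn.
  have zy : (- y^-1) ^+ (n - k) * (- y) ^+ (n - k) = 1.
    by rewrite -exprMn mulrNN mulVf// expr1n.
  rewrite -exprM mul2n -addnn -[X in (_ ^+ (X + n)%N)](subnK kn) -addnA.
  rewrite [(k + n)%N]addnC [in RHS]exprD; move: zy.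
  move: (_ ^+ (n - k)) (_ ^+ (n - k)) (_ ^+ (n + k)) (bol_coef _ _ _) => u v w c uv.
  by rewrite -[LHS]mul1r -uv; ring.
elim: n y y0 => [|n IH] y y0.
  by rewrite derive1n0 ga// big_ord1 /bol_coef bin0 big_geq//=; ring.
have y2 : 0 < y ^+ 2 by rewrite exprn_even_gt0.
have dy : is_derive y 1 (fun z : R => - z^-1) ((- y^-1) ^+ 2).
  have h := is_deriveN (is_deriveV y0 (is_derive_id y (1 : R))).
  by apply: (is_derive_eq h); rewrite /GRing.scale /= mulr1 opprK sqrrN exprVn.
have da k := @is_derive1_comp R (derive1n k (a true)) (fun z : R => - z^-1)
  _ _ _
  (smooth_is_derive k (- y^-1) (sa true)) dy.
have dsq : is_derive y 1 (fun z : R => z ^+ 2) (2 * y).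
  have h := is_deriveX 2 (is_derive_id y (1 : R)).
  by apply: (is_derive_eq h); rewrite /GRing.scale /= mulr1 expr1.
have dp := @is_derive1_comp R (fun z : R => z `^ (- lam))
  (fun z : R => z ^+ 2) _ _ _ (is_derive1_powR (- lam) y2) dsq.
have dpE : - lam * (y ^+ 2) `^ (- lam - 1) * (2 * y) =
    2 * lam * (- y^-1) * (y ^+ 2) `^ (- lam).
  rewrite powRD ?(gt_eqF y2) ?implybT// powR_inv1 ?ltW//.
  by move: (_ `^ _) => P; field.
have dS k := is_deriveZ (bol_coef lam n k)
  (is_deriveM (is_deriveX (n + k) dy) (da k)).
have hS := @is_derive_big_sum R 'I_n.+1 (index_enum _) xpredT
  (fun k => _) _ y (fun k => dS (nat_of_ord k)).
have h := is_deriveM dp hS.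
rewrite derive1nS derive1E.
transitivity ('D_1 ((((fun z : R => z `^ (- lam)) \o (fun z : R => z ^+ 2))) *
  (fun t : R => \sum_(k < n.+1)
    (bol_coef lam n k *: (((fun z : R => - z^-1) ^+ (n + k)%N)
    * (derive1n k (a true) \o (fun z : R => - z^-1)))) t)) y).
  apply: near_eq_derive => /=.
  have : \forall z \near y, z != 0 by exact: (open_neq y0).
  apply: filterS => z z0; rewrite IH// !fctE /=; congr (_ * _).
  by apply: eq_bigr => k _; rewrite !fctE.
case: h => _ ->; rewrite dpE {dpE hS dS dp dsq da dy IH}.
pose g k : R := derive1n k (a true) (- y^-1).
(* [A] collects the derivatives of the prefactor and of the power of z, [B] those of the jet of
   [a true]. *)
pose A k : R := (2 * lam + n%:R + k%:R) * bol_coef lam n k *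
  (- y^-1) ^+ (n + k).+1 * g k.
pose B k : R := bol_coef lam n k * (- y^-1) ^+ (n + k).+2 * g k.+1.
transitivity ((y ^+ 2) `^ (- lam) *
  (\sum_(k < n.+1) A k + \sum_(k < n.+1) B k)).
  rewrite !fctE /GRing.scale /= [X in _ + X]mulrA [X in _ + X]mulrC -mulrDr.
  congr (_ * _).
  rewrite mulr_suml -!big_split; apply: eq_bigr => k _ /=; rewrite !fctE.
  rewrite /A /B -/(g k) -/(g k.+1).
  rewrite -derive1nS -/(g k.+1) /GRing.scale /=; move: (g k) (g k.+1) => g0 g1.
  (* The derivative of z^(n+k) contains the truncated exponent n + k - 1, hence the separate case n
     + k = 0. *)
  rewrite -[2 * lam + _ + _]addrA -natrD; case: (n + k)%N => [|q] /=.
    have e (c z p0 p1 : R) : c * (1 * (p1 * z ^+ 2) + p0 * (0 * 1 * z ^+ 2)) +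
      c * (1 * p0) * (2 * lam * z) =
      (2 * lam + 0) * c * z * p0 + c * z ^+ 2 * p1 by ring.
    exact: e.
  have e (c z p0 p1 : R) :
    c * (z ^+ q.+1 * (p1 * z ^+ 2) + p0 * (q.+1%:R * z ^+ q * z ^+ 2)) +
    c * (z ^+ q.+1 * p0) * (2 * lam * z) =
    (2 * lam + q.+1%:R) * c * z ^+ q.+2 * p0 + c * z ^+ q.+3 * p1.
    by rewrite !exprS; move: (z ^+ q) => w; ring.
  exact: e.
congr (_ * _); rewrite [RHS]big_ord_recl /= bol_coefS0 addn0.
have S k : bol_coef lam n.+1 k.+1 * ((- y^-1) ^+ (n.+1 + k.+1) * g k.+1) =
    A k.+1 + B k.
  rewrite bol_coefSS /A /B !addnS !addSn.
  by move: (_ ^+ _) (g _) => w d; ring.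
(* The added term [A n.+1] is zero since C(n,n+1) = 0; the shifted sum can then be matched with [B]
   through [S]. *)
have -> : \sum_(k < n.+1) A k = A 0%N + \sum_(k < n.+1) A k.+1.
  rewrite -(big_ord_recl n.+1 (fun k : 'I_n.+2 => A k)) [RHS]big_ord_recr /=.
  by rewrite /A /bol_coef bin_small// !(mul0r, mulr0) addr0.
rewrite -addrA -big_split /=; congr (_ + _).
  by rewrite /A /g addn0 mulr0n addr0 -mulrA.
by apply: eq_bigr => k _; rewrite -S.
Qed.

(** * Smoothness of pairings and quadratic vector fields *)

Lemma smooth_derive1n (R : realType) (f : R -> R) (n : nat) :
  smooth f -> smooth (derive1n n f).
Proof.
by move=> sf; elim: n => // n IH; rewrite derive1nS; exact: smooth_derive1.
Qed.

Lemma derive1nD (R : realType) (f g : R -> R) (n : nat) :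
  smooth f -> smooth g -> derive1n n (f + g) = derive1n n f + derive1n n g.
Proof.
move=> sf sg; elim: n => // n IH; rewrite !derive1nS IH.
by apply/funext => x; rewrite !fctE !derive1E deriveD; [|exact: sf|exact: sg].
Qed.

Lemma smooth_big_sum (R : realType) (I : Type) (r : seq I) (P : pred I)
    (f : I -> R -> R) : (forall i, smooth (f i)) ->
  smooth (fun x => \sum_(i <- r | P i) f i x).
Proof.
move=> sf; elim: r => [|i r IH].
  by under eq_fun do rewrite big_nil; exact: smooth_cst.
under eq_fun do rewrite big_cons.
by case: (P i) => //; exact: (smoothD (sf i) IH).
Qed.

Lemma smooth_big_prod (R : realType) (I : Type) (r : seq I)
    (f : I -> R -> R) : (forall i, smooth (f i)) ->
  smooth (fun x => \prod_(i <- r) f i x).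
Proof.
move=> sf; elim: r => [|i r IH].
  by under eq_fun do rewrite big_nil; exact: smooth_cst.
by under eq_fun do rewrite big_cons; exact: (smoothM (sf i) IH).
Qed.

Lemma smooth_pairing (R : realType) (m k n : nat) (beta : multinom m -> R)
    (v0 : nat -> R -> R) (v : 'I_m -> nat -> R -> R) :
  (forall i, smooth (v0 i)) -> (forall j i, smooth (v j i)) ->
  smooth (fun x => pairing k n beta (v0^~ x) (fun j i => v j i x)).
Proof.
move=> s0 s; apply: smooth_big_sum => i.
apply: (@smoothZ R (beta i)
  (v0 (n - mdeg i)%N * (fun x => \prod_(j < m) v j (i j) x))).
by apply: smoothM => //; exact: smooth_big_prod.
Qed.

Lemma derive1_quadratic (R : realType) (a b c : R) :
  derive1 (fun x => a + b * x + c * x ^+ 2) =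
  (fun x => b + 2 * c * x + 0 * x ^+ 2).
Proof.
apply/funext => x; apply: is_derive_derive1.
have dx := is_derive_id x (1 : R).
have h := is_deriveD (is_deriveD (is_derive_cst a x 1) (is_deriveZ b dx))
  (is_deriveZ c (is_deriveX 2 dx)).
by apply: (is_derive_eq h); rewrite /GRing.scale /=; ring.
Qed.

Lemma sl2_derive1n3 (R : realType) (M : curve) (X : vect R M) (c : chart M)
    (x : R) : sl2 X -> derive1n 3 (X c) x = 0.
Proof.
move=> [u [v [w ->]]]; set Y := (X in derive1n 3 X).
suff [a0 [a1 [a2 ->]]] : exists a0 a1 a2,
    Y = (fun x => a0 + a1 * x + a2 * x ^+ 2).
  by rewrite /= !derive1_quadratic; ring.
rewrite {}/Y {X}; case: M c => c.
  exists u, v, w; apply/funext => y.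
  by rewrite /= !fctE /GRing.scale /=; ring.
(* At infinity [x^n d/dx] reads [(-1)^n y^(2-n) d/dy], which reverses the coefficients and negates
   the middle one. *)
case: c; [exists u, v, w|exists w, (- v), u]; apply/funext => y;
  by rewrite /= !fctE /GRing.scale /=; ring.
Qed.

(** * Pairing the jets of densities *)

Definition jet (R : realType) (f : R -> R) (x : R) (n : nat) : R :=
  derive1n n f x.

Lemma is_derive_pairing_jet (R : realType) (m k n : nat) (beta : multinom m -> R)
    (f0 : R -> R) (f : 'I_m -> R -> R) (x : R) :
  smooth f0 -> (forall j, smooth (f j)) ->
  is_derive x 1 (fun t => pairing k n beta (jet f0 t) (fun j => jet (f j) t))
    (pairing_polar k n beta (fun i => jet f0 x i.+1)
      (fun j i => jet (f j) x i.+1) (jet f0 x) (fun j => jet (f j) x)).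
Proof.
by move=> s0 s; apply: is_derive_pairing => [i|j i]; exact: smooth_is_derive.
Qed.

Lemma pairing_bol (R : realType) (m k n : nat) (lam0 : R) (lam : 'I_m -> R)
    (beta : multinom m -> R) (g0 : nat -> R) (g : 'I_m -> nat -> R) (t : R) :
  (n <= k)%N -> sl2_invariant n lam0 lam beta ->
  pairing k n beta (fun i => bol lam0 g0 i t) (fun j i => bol (lam j) (g j) i t)
  = pairing k n beta g0 g.
Proof.
move=> nk inv.
have -> : pairing k n beta g0 g = pairing k n beta (fun i => bol lam0 g0 i 0)
    (fun j i => bol (lam j) (g j) i 0).
  apply: eq_bigr => i _; rewrite bol0; do 2!congr (_ * _).
  by apply: eq_bigr => j _; rewrite bol0.
apply: (@is_derive_0_is_cst _ (fun t => pairing k n beta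
  (fun i => bol lam0 g0 i t) (fun j i => bol (lam j) (g j) i t))) => x.
rewrite -(pairing_polar_lowering (fun i => bol lam0 g0 i x)
  (fun j i => bol (lam j) (g j) i x) nk inv).
apply: is_derive_pairing => [i|j i]; exact: is_derive_bol.
Qed.

(** In Bol's formula each density contributes its own weight and each derivative a factor y^-2. The
    n derivatives of every monomial therefore add n to the total weight, and the remaining [bol]
    curves are removed by [pairing_bol]. *)
Lemma pairing_jet_infinity (R : realType) (m k n : nat) (lam0 : R)
    (lam : 'I_m -> R) (beta : multinom m -> R) (a : density Circle lam0)
    (phi : forall j, density Circle (lam j)) (y : R) :
  (n <= k)%N -> sl2_invariant n lam0 lam beta -> y != 0 ->
  pairing k n beta (jet (a false) y) (fun j => jet (phi j false) y) =
  pairing k n beta (jet (a true) (- y^-1)) (fun j => jet (phi j true) (- y^-1))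
    * (y ^+ 2) `^ (- (lam0 + n%:R + \sum_(j < m) lam j)).
Proof.
move=> nk inv y0; have y2 : 0 < y ^+ 2 by rewrite exprn_even_gt0.
rewrite -[in RHS](pairing_bol _ _ (- y) nk inv) mulrC.
have -> : (y ^+ 2) `^ (- (lam0 + n%:R + \sum_(j < m) lam j)) =
    (y ^+ 2) `^ (- lam0) * (\prod_(j < m) (y ^+ 2) `^ (- lam j)) * (y ^- 2) ^+ n.
  have -> : \prod_(j < m) (y ^+ 2) `^ (- lam j) =
      (y ^+ 2) `^ (- \sum_(j < m) lam j).
    elim/big_ind2: _ => [|p q r s -> ->|//]; first by rewrite oppr0 powRr0.
    by rewrite opprD powRD// (gt_eqF y2) implybT.
  rewrite -(powR_mulrn n) ?invr_ge0 ?sqr_ge0// -powR_inv1 ?sqr_ge0// -powRrM.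
  rewrite -!powRD ?(gt_eqF y2) ?implybT//; congr (_ `^ _); ring.
rewrite -pairing_scale; apply: eq_bigr => i _.
rewrite /jet derive1n_infinity//; do 2!congr (_ * _).
by apply: eq_bigr => j _; rewrite derive1n_infinity.
Qed.

Lemma pairing_jet_lie (R : realType) (M : curve) (m k n : nat) (lam0 : R)
    (lam : 'I_m -> R) (beta : multinom m -> R) (X : vect R M)
    (a : density M lam0) (phi : forall j, density M (lam j)) (c : chart M)
    (x : R) : (n <= k)%N -> sl2_invariant n lam0 lam beta -> sl2 X ->
  pairing k n beta (jet (lie X a c) x) (fun j => jet (phi j c) x) =
  X c x * derive1 (fun t => pairing k n beta (jet (a c) t)
                              (fun j => jet (phi j c) t)) x
  + (lam0 + n%:R + \sum_(j < m) lam j) * (derive1 (X c) x *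
      pairing k n beta (jet (a c) x) (fun j => jet (phi j c) x))
  - \sum_(j < m) pairing k n beta (jet (a c) x)
      (fun l => jet (dfwith phi j (lie X (phi j)) l c) x).
Proof.
move=> nk inv slX; have [sX _] := densityP X.
have [sa _] := densityP a; have sphi j := (densityP (phi j)).1 c.
have jlie (l0 : R) (b : density M l0) : (forall c, smooth (b c)) ->
    jet (lie X b c) x = (fun i => X c x * jet (b c) x i.+1 +
      derive1 (X c) x * ((i%:R + l0) * jet (b c) x i) +
      derive1n 2 (X c) x / 2 * lowering l0 (jet (b c) x) i).
  move=> sb; apply/funext => i; apply: derive1n_lie => //.
  by move=> y; exact: sl2_derive1n3.
rewrite (is_derive_derive1 (is_derive_pairing_jet _ _ _ _ (sa c) sphi)).
(* With the slotwise sum moved to the left, that side is the polarization along all the Lie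
   derivatives at once, by [pairing_polarE]. *)
apply/eqP; rewrite -subr_eq0 opprB addrA subr_eq0; apply/eqP.
transitivity (pairing_polar k n beta (jet (lie X a c) x)
  (fun j => jet (lie X (phi j) c) x) (jet (a c) x) (fun j => jet (phi j c) x)).
  rewrite pairing_polarE; congr (_ + _).
  apply: eq_bigr => j _; apply: eq_bigr => i _.
  do 2!congr (_ * _); apply: eq_bigr => l _; case: eqVneq => [->|lj].
    by rewrite dfwithin.
  by rewrite dfwithout// eq_sym.
rewrite jlie//.
have -> : (fun j => jet (lie X (phi j) c) x) =
    (fun j i => X c x * jet (phi j c) x i.+1 +
      derive1 (X c) x * ((i%:R + lam j) * jet (phi j c) x i) +
      derive1n 2 (X c) x / 2 * lowering (lam j) (jet (phi j c) x) i).
  by apply/funext => j; rewrite jlie// => d; exact: (densityP (phi j)).1.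
rewrite pairing_polarD pairing_polar_euler (pairing_polar_lowering _ _ nk inv).
by ring.
Qed.

(** * Solving the induction formula *)

(** The induction formula solved for its lower coefficient. Here [n] is the degree of the upper
    index, and [d] is meant to be n - |i|, so that [d = 0] is the prescribed top degree. *)
Fixpoint descend (R : fieldType) (m : nat) (lam : 'I_m -> R) (delta : R)
    (n : nat) (top : multinom m -> R) (d : nat) (i : multinom m) : R :=
  if d is d'.+1 then
    - (\sum_(j < m) ((i j)%:R + 1) * (2 * lam j + (i j)%:R) *
         descend lam delta n top d' (mnm_add i (mnm1 j))) /
      ((2 * delta - 1 - n%:R - (mdeg i)%:R) * (n%:R - (mdeg i)%:R))
  else top i.

(** The matrices are indexed by ranks in an enumeration; the indicator recovers the entry from the
    multi-indices themselves and yields 0 when their degrees differ. *)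
Definition top_coef (R : realType) (m k : nat)
    (B : forall p : 'I_k.+1, 'M[R]_#|homogeneous m p|) (s i : multinom m) : R :=
  \sum_(p < k.+1) \sum_(a < #|homogeneous m p|)
    \sum_(b < #|homogeneous m p|)
      ((enum_val a == s :> multinom m) && (enum_val b == i :> multinom m))%:R
        * B p a b.

Definition extension (R : realType) (m k : nat) (lam : 'I_m -> R) (delta : R)
    (B : forall p : 'I_k.+1, 'M[R]_#|homogeneous m p|) (s i : multinom m) : R :=
  descend lam delta (mdeg s) (top_coef B s) (mdeg s - mdeg i) i.

Lemma mdeg_homogeneous (m p : nat) (a : 'I_#|homogeneous m p|) :
  mdeg (enum_val a) = p.
Proof. by have := enum_valP a; rewrite inE => /eqP. Qed.

Lemma extension_top (R : realType) (m k : nat) (lam : 'I_m -> R) (delta : R)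
    (B : forall p : 'I_k.+1, 'M[R]_#|homogeneous m p|) :
  extends_top B (extension lam delta B).
Proof.
move=> p a b; rewrite /extension !mdeg_homogeneous subnn /= /top_coef.
rewrite (bigD1 p)//= [X in _ + X]big1 ?addr0; last first.
  move=> q qp; rewrite big1// => a' _; rewrite big1// => b' _.
  case: eqP => [e|_]; last by rewrite mul0r.
  case/eqP: qp; apply: val_inj => /=.
  by rewrite -(mdeg_homogeneous a') e mdeg_homogeneous.
rewrite (bigD1 a)//= [X in _ + X]big1 ?addr0; last first.
  move=> a' a'a; rewrite big1// => b' _.
  case: eqP => [e|_]; last by rewrite mul0r.
  by case/eqP: a'a; apply: enum_val_inj; exact: val_inj.
rewrite (bigD1 b)//= [X in _ + X]big1 ?addr0 ?eqxx ?mul1r//.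
move=> b' b'b; case: (enum_val b' =P _ :> multinom m) => [e|_].
  by case/eqP: b'b; apply: enum_val_inj; exact: val_inj.
by rewrite andbF mul0r.
Qed.

(** The first factor vanishes only at delta = (n + i + 1)/2, and i < n <= k places n + i + 1 between
    2 and 2k, so this value is excluded. *)
Lemma denominator_neq0 (R : realType) (k n i : nat) (delta : R) :
  (forall l : nat, (2 <= l <= 2 * k)%N -> delta <> l%:R / 2) ->
  (i < n <= k)%N ->
  (2 * delta - 1 - n%:R - i%:R) * (n%:R - i%:R) != 0.
Proof.
move=> nonres /andP[i_n nk]; apply: mulf_neq0; last first.
  by rewrite subr_eq0 eqr_nat gtn_eqF.
have rng : (2 <= (n + i).+1 <= 2 * k)%N.
  rewrite ltnS (leq_trans (_ : 0 < n)%N) ?leq_addr ?(leq_ltn_trans _ i_n)//=.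
  by rewrite mul2n -addnn -addnS leq_add// (leq_trans i_n).
apply/eqP => e; apply: (nonres _ rng); rewrite -natr1 natrD; lra.
Qed.

Lemma extension_formula (R : realType) (m k : nat) (lam : 'I_m -> R) (delta : R)
    (B : forall p : 'I_k.+1, 'M[R]_#|homogeneous m p|) :
  (forall l : nat, (2 <= l <= 2 * k)%N -> delta <> l%:R / 2) ->
  induction_formula k lam delta (extension lam delta B).
Proof.
move=> nonres s i i_s; have dn := denominator_neq0 nonres i_s.
have /andP[lt_is _] := i_s.
(* The gap is positive, so it is exposed as a successor and [descend] unfolds exactly once. *)
rewrite {1}/extension -[(mdeg s - mdeg i)%N]prednK ?subn_gt0//=.
rewrite mulrC divfK// addrC; apply/eqP; rewrite subr_eq0; apply/eqP.
apply: eq_bigr => j _; congr (_ * _); rewrite /extension mdegD mdeg1 addn1.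
by rewrite subnS.
Qed.

Lemma extends_top_unique (R : realType) (m k : nat)
    (B : forall p : 'I_k.+1, 'M[R]_#|homogeneous m p|)
    (beta beta' : multinom m -> multinom m -> R) (s i : multinom m) :
  extends_top B beta -> extends_top B beta' -> mdeg i = mdeg s ->
  (mdeg s <= k)%N -> beta' s i = beta s i.
Proof.
move=> tb tb' i_s sk; have sk' : (mdeg s < k.+1)%N by rewrite ltnS.
have lt_s : (mdeg s < (Ordinal sk').+1)%N by [].
have lt_i : (mdeg i < (Ordinal sk').+1)%N by rewrite i_s.
have hs : BMultinom lt_s \in homogeneous m (Ordinal sk') by rewrite inE /=.
have hi : BMultinom lt_i \in homogeneous m (Ordinal sk') by rewrite inE /= i_s.
have := tb' _ (enum_rank_in hs (BMultinom lt_s))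
  (enum_rank_in hs (BMultinom lt_i)).
by rewrite -tb !enum_rankK_in.
Qed.

(** Induction on the gap |s| - |i|: gap 0 is fixed by [B], and otherwise the nonzero factor of
    beta^s_i lets the formula determine it from the indices i + 1_j, whose gap is smaller by one. *)
Lemma induction_formula_unique (R : realType) (m k : nat) (lam : 'I_m -> R)
    (delta : R) (B : forall p : 'I_k.+1, 'M[R]_#|homogeneous m p|)
    (beta beta' : multinom m -> multinom m -> R) :
  (forall l : nat, (2 <= l <= 2 * k)%N -> delta <> l%:R / 2) ->
  extends_top B beta -> induction_formula k lam delta beta ->
  extends_top B beta' -> induction_formula k lam delta beta' ->
  forall s i : multinom m, (mdeg i <= mdeg s <= k)%N -> beta' s i = beta s i.
Proof.
move=> nonres tb fb tb' fb' s i /andP[i_s sk].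
have [d] := ubnP (mdeg s - mdeg i); elim: d i i_s => // d IH i i_s ltd.
move: i_s; rewrite leq_eqVlt => /orP[/eqP e|lt_is].
  exact: (extends_top_unique tb tb').
have is_k : (mdeg i < mdeg s <= k)%N by rewrite lt_is.
apply: (mulfI (denominator_neq0 nonres is_k)).
have := fb' s i is_k; rewrite -[RHS](fb s i is_k).
rewrite (eq_bigr (fun j => ((i j)%:R + 1) * (2 * lam j + (i j)%:R) *
  beta s (mnm_add i (mnm1 j)))) => [/addIr//|j _].
congr (_ * _); apply: IH; rewrite mdegD mdeg1 addn1//.
by rewrite subnS -ltnS prednK// subn_gt0.
Qed.

(** Slot 0 receives the symbol component a_s, of weight delta - n with n = |s|, and n - |i| - 1 +
    2(delta - n) = 2 delta - 1 - n - |i|. *)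
Lemma induction_formula_sl2_invariant (R : realType) (m k : nat)
    (lam : 'I_m -> R) (delta : R) (beta : multinom m -> multinom m -> R)
    (s : multinom m) : induction_formula k lam delta beta -> (mdeg s <= k)%N ->
  sl2_invariant (mdeg s) (delta - (mdeg s)%:R) lam (beta s).
Proof.
move=> fb sk i i_s; rewrite -[RHS](fb s i); last by rewrite i_s.
congr (_ * _ + _); last first.
  by apply: eq_bigr => j _; congr (_ * _); rewrite -natr1 [2 * _ + _]addrC.
have -> : (mdeg s - mdeg i).-1%:R = (mdeg s)%:R - (mdeg i)%:R - 1 :> R.
  by rewrite -subn1 natrB ?subn_gt0// natrB// ltnW.
by rewrite natrB 1?ltnW//; ring.
Qed.

(** * The quantization map *)

Lemma density_sumE (R : realType) (M : curve) (lam : R) (I : Type) (r : seq I)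
    (F : I -> density M lam) (c : chart M) (x : R) :
  (\sum_(i <- r) F i) c x = \sum_(i <- r) F i c x.
Proof.
by elim/big_ind2 : _ => // d p e q <- <-.
Qed.

(** Summed over the upper index first, because each [s] gives a form that is invariant by itself.
    The same formula is used in every chart. *)
Definition quantization (R : realType) (M : curve) (m k : nat) (delta : R)
    (lam : 'I_m -> R) (beta : multinom m -> multinom m -> R)
    (a : symbol M m k delta) (phi : forall j, density M (lam j)) :
    chart M -> R -> R :=
  fun c x => \sum_(s : bmultinom m k.+1)
    pairing k (mdeg s) (beta s) (jet (a s c) x) (fun j => jet (phi j c) x).

Lemma quantizationE (R : realType) (M : curve) (m k : nat) (delta : R)
    (lam : 'I_m -> R) (beta : multinom m -> multinom m -> R)
    (a : symbol M m k delta) (phi : forall j, density M (lam j)) c x :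
  quantization beta a phi c x = \sum_(i : bmultinom m k.+1)
    (\sum_(s : bmultinom m k.+1 | (mdeg i <= mdeg s)%N)
      beta s i * derive1n (mdeg s - mdeg i) (a s c) x) *
    \prod_(j < m) derive1n (i j) (phi j c) x.
Proof.
rewrite /quantization /pairing (exchange_big_dep xpredT)//=.
apply: eq_bigr => i _; rewrite mulr_suml; apply: eq_bigr => s _.
by rewrite mulrA.
Qed.

(** The summand at s glues with weight (delta - |s|) + |s| + sum of the [lam j]. This equals [mu]
    for every s, so the whole sum glues as a density of weight [mu]. *)
Lemma quantization_density (R : realType) (M : curve) (m k : nat) (delta mu : R)
    (lam : 'I_m -> R) (beta : multinom m -> multinom m -> R)
    (a : symbol M m k delta) (phi : forall j, density M (lam j)) :
  delta = mu - \sum_(j < m) lam j -> induction_formula k lam delta beta ->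
  density_pred mu (quantization beta a phi).
Proof.
move=> deltaE fb; apply/asboolP; split.
  move=> c; apply: smooth_big_sum => s; apply: smooth_pairing => [n|j n].
    exact/smooth_derive1n/(densityP (a s)).1.
  exact/smooth_derive1n/(densityP (phi j)).1.
case: M a phi => // a phi y y0; rewrite /quantization mulr_suml.
apply: eq_bigr => s _; have sk : (mdeg s <= k)%N by rewrite -ltnS bmdeg.
rewrite (pairing_jet_infinity _ _ sk (induction_formula_sl2_invariant fb sk) y0).
by rewrite subrK -[mu](subrK (\sum_(j < m) lam j)) -deltaE.
Qed.

Lemma quantization_lie (R : realType) (M : curve) (m k : nat) (delta mu : R)
    (lam : 'I_m -> R) (beta : multinom m -> multinom m -> R) (X : vect R M)
    (a : symbol M m k delta) (phi : forall j, density M (lam j)) c x :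
  delta = mu - \sum_(j < m) lam j -> induction_formula k lam delta beta ->
  sl2 X ->
  quantization beta (lie_symbol X a) phi c x =
  lie_coef X mu (quantization beta a phi) c x -
  \sum_(j < m) quantization beta a (dfwith phi j (lie X (phi j))) c x.
Proof.
move=> deltaE fb slX; rewrite exchange_big /=.
have sa s := (densityP (a s)).1 c; have sphi j := (densityP (phi j)).1 c.
have dQ : derive1 (quantization beta a phi c) x = \sum_(s : bmultinom m k.+1)
    derive1 (fun t => pairing k (mdeg s) (beta s) (jet (a s c) t)
                        (fun j => jet (phi j c) t)) x.
  apply/is_derive_derive1/is_derive_big_sum => s.
  have h := is_derive_pairing_jet k (mdeg s) (beta s) x (sa s) sphi.
  by rewrite (is_derive_derive1 h).
rewrite /lie_coef !fctE /GRing.scale /= dQ !mulr_sumr -big_split -sumrB /=.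
apply: eq_bigr => s _; have sk : (mdeg s <= k)%N by rewrite -ltnS bmdeg.
rewrite (pairing_jet_lie _ _ _ _ sk (induction_formula_sl2_invariant fb sk) slX).
by rewrite subrK -[mu](subrK (\sum_(j < m) lam j)) -deltaE.
Qed.

Lemma quantization_linear (R : realType) (M : curve) (m k : nat) (delta : R)
    (lam : 'I_m -> R) (beta : multinom m -> multinom m -> R) (t : R)
    (a b : symbol M m k delta) (phi : forall j, density M (lam j)) c x :
  quantization beta (fun s => t *: a s + b s) phi c x =
  t * quantization beta a phi c x + quantization beta b phi c x.
Proof.
rewrite mulr_sumr -big_split; apply: eq_bigr => s _ /=.
rewrite mulr_sumr -big_split; apply: eq_bigr => i _ /=.
have sa := (densityP (a s)).1 c; have sb := (densityP (b s)).1 c.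
have -> n : jet ((t *: a s + b s : density M _) c) x n =
    t * jet (a s c) x n + jet (b s c) x n.
  rewrite /jet (derive1nD _ (smoothZ sa) sb) derive1nZ//.
by ring.
Qed.

Theorem theorem4p3 (R : realType) (M : curve) (m k : nat) (m_gt0 : (0 < m)%N)
    (lam : 'I_m -> R) (mu delta : R)
    (delta_def : delta = mu - \sum_(j < m) lam j)
    (delta_nonres : forall l : nat, (2 <= l <= 2 * k)%N -> delta <> l%:R / 2)
    (B : forall p : 'I_k.+1, 'M[R]_#|homogeneous m p|)
    (B_unit : forall p, B p \in unitmx) :
  exists beta : multinom m -> multinom m -> R,
    [/\ extends_top B beta,
        induction_formula k lam delta beta,
        (forall beta',
           extends_top B beta' -> induction_formula k lam delta beta' ->
           forall s i : multinom m, (mdeg i <= mdeg s <= k)%N ->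
             beta' s i = beta s i)
      & exists Q : symbol M m k delta -> operator M lam mu,
          [/\ (forall a, diffop k (Q a)),
              (forall a phi x, Q a phi (affine M) x =
                 \sum_(i : bmultinom m k.+1) quantized_coef beta a i x
                   * \prod_(j < m) derive1n (i j) (phi j (affine M)) x),
              (forall (t : R) (a b : symbol M m k delta),
                 Q (fun s => t *: a s + b s) = t *: Q a + Q b)
            & (forall X : vect R M, sl2 X ->
                 forall a, Q (lie_symbol X a) = lie_op X (Q a))]].
Proof.
exists (extension lam delta B).
have top := @extension_top R m k lam delta B.
have fb := extension_formula lam B delta_nonres.
split=> //; first by move=> beta'; exact: induction_formula_unique.
exists (fun a phi => Density (quantization_density a phi delta_def fb)).
split.
(* [quantizationE] holds in each chart, so it supplies the coefficients of the differential operator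
   at infinity as well as in the affine chart. *)
- move=> a c; eexists; last first.
    by move=> phi x; rewrite /= quantizationE; reflexivity.
  move=> i /=; apply: smooth_big_sum => s.
  exact/(@smoothZ R)/smooth_derive1n/(densityP (a s)).1.
- by move=> a phi x; rewrite /= quantizationE.
- move=> t a b; apply/funext => phi; apply: val_inj => /=.
  by apply/funext => c; apply/funext => x; rewrite quantization_linear.
move=> X slX a; apply/funext => phi; apply: val_inj => /=.
apply/funext => c; apply/funext => x.
rewrite (quantization_lie _ _ _ _ delta_def fb slX) /lie_op /= !fctE.
by rewrite density_sumE.
Qed.
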